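(* Let $0<p<1$, let $(\Omega,\mu)$ be a measure space, and let $x,y\in L_p(\Omega;\mathbb R)$ satisfy $x+y\ge0$ and $x-y\ge0$ almost everywhere on $\Omega$. Then $$\|x+y\|_{L_p}^2\ \le\ \|x\|_{L_p}^2+2\langle J_{L_p,+}(x),y\rangle+p\,2^{2/p-2}\|y\|_{L_p}^2 .$$ The coefficient $p\,2^{2/p-2}$ is optimal, i.e. it is the smallest constant for which this inequality holds for all measure spaces and all such $x,y$.
   Context: For $0<p<1$, $L_p(\Omega;\mathbb R)$ is the space of real measurable functions with $\|x\|_{L_p}=\left(\int_\Omega|x|^p\,d\mu\right)^{1/p}<\infty$. For $x,y\in L_p(\Omega;\mathbb R)$ with $x\pm y\ge0$ a.e., the positive-cone tangent form is $$\langle J_{L_p,+}(x),y\rangle:=\|x\|_{L_p}^{2-p}\int_{\{x>0\}}x^{p-1}y\,d\mu\quad\text{if }x\ne0,\qquad \langle J_{L_p,+}(x),y\rangle:=0\quad\text{if }x=0$$ (the integral is finite since $|y|\le x$). *)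

(* Defs.v *)
From mathcomp Require Import all_boot all_order all_algebra.
From mathcomp Require Import all_classical all_reals all_analysis.

Set Implicit Arguments.
Unset Strict Implicit.
Unset Printing Implicit Defensive.
Import Order.TTheory GRing.Theory Num.Theory.

Local Open Scope classical_set_scope.
Local Open Scope ring_scope.

(* Elements of L_p are represented by functions f with f \in Lfun mu p%:E
   (measurable, with finite 'N[mu]_p%:E), so "fine" below loses nothing. *)
Definition Lp_norm (R : realType) (d : measure_display) (T : measurableType d)
    (mu : {measure set T -> \bar R}) (p : R) (f : T -> R) : R :=
  fine ('N[mu]_(p%:E)[EFin \o f])%E.

(* "x = 0" is equality in L_p, i.e. almost everywhere.  Only meaningful for
   `|y| <= x a.e., which makes the integral finite; Rintegral returns 0 on
   infinite or undefined integrals. *)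
Definition cone_tangent (R : realType) (d : measure_display)
    (T : measurableType d) (mu : {measure set T -> \bar R}) (p : R)
    (x y : T -> R) : R :=
  if `[< {ae mu, forall t, x t = 0} >] then 0
  else Lp_norm mu p x `^ (2 - p) *
       \int[mu]_(t in [set t | 0 < x t]) (x t `^ (p - 1) * y t).

Definition cone_smooth_with (R : realType) (p C : R) : Prop :=
  forall (d : measure_display) (T : measurableType d)
         (mu : {measure set T -> \bar R}) (x y : T -> R),
    x \in Lfun mu p%:E -> y \in Lfun mu p%:E ->
    {ae mu, forall t, 0 <= x t + y t} ->
    {ae mu, forall t, 0 <= x t - y t} ->
    Lp_norm mu p (x \+ y) ^+ 2 <=
      Lp_norm mu p x ^+ 2 + 2 * cone_tangent mu p x y
      + C * Lp_norm mu p y ^+ 2.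

(* Main.v *)
Require Import Defs.
From mathcomp Require Import all_boot all_order all_algebra.
From mathcomp Require Import all_classical all_reals all_analysis.
From mathcomp Require Import measurable_realfun.
From mathcomp Require Import ring lra.
Import Order.TTheory GRing.Theory Num.Theory.
Import numFieldNormedType.Exports.
Local Open Scope classical_set_scope.
Local Open Scope ring_scope.

(** Write [y = z x] with [`|z| <= 1] on [{x > 0}], [w = x^p], and follow the
    segment from [x] to [x + y]:
      [S(s) = \int w (1 + s z)^p] and [F(s) = S(s)^(2/p)], the square of the
    quasi-norm of [x + s y].  Then [F'(0)] is twice the tangent form, so by
    Taylor's formula the inequality follows from [F'' <= 2 c D^(2/p)], where
    [c = p 2^(2/p-2)] and [D = \int w |z|^p], whose power [D^(2/p)] is the square
    of the quasi-norm of [y].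

    Differentiating twice under the integral gives
      [F'' / 2 = (2-p) S^(2/p-2) A^2 - (1-p) S^(2/p-1) Q],
    where [A] and [Q] are the integrals of [u] and [u^2], [u = z / (1 + s z)],
    against the weight [W = w (1 + s z)^p], while [S] and [D] are those of [1]
    and [|u|^p].  Since [1] lies between [p] and [2], Young's inequality bounds
    [A] by [D] and [Q] (young_interpolation); this trades the negative term in
    [Q] for one in [A], and a second use of Young's inequality (young_extremal)
    removes [A].  Both are equalities when [|u|] is [0] on half of the total
    weight and a constant on the other half, and this is where [c] comes from
    (integral_second_variation_le).

    Differentiation under the integral is legitimate for [s < 1], as then
    [1 + s z >= 1 - s > 0].  The endpoint [s = 1] is recovered from
    [x + s y >= s (x + y)], which gives [s^2 F(1) <= F(s)] and lets [s] tend to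
    [1] in a polynomial inequality (quadratic_le_at1).

    For optimality, the equality case above is realised by two atoms of mass
    one, [x = 1] and [y] equal to a small [s] on one atom and to [0] on the
    other: there [F''(0) = 2 c], so no smaller constant can work
    (powR_second_order_lower). *)

(** * Two instances of Young's inequality *)

(** The exponent [1] is the barycentre of [p] and [2] with weights [1 / (2 - p)]
    and [(1 - p) / (2 - p)], so this is the weighted arithmetic-geometric mean
    inequality for [c^(2-p) u^p] and [u^2].  Equality holds at [u = c]; the free
    parameter [c] makes the integrated form as sharp as Hoelder's inequality. *)
Lemma young_interpolation (R : realType) (p c u : R) :
  p < 1 -> 0 <= c -> 0 <= u ->
  (2 - p) * (c * u) <= c `^ (2 - p) * u `^ p + (1 - p) * u ^+ 2.
Proof.
move=> p1 c0 u0.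
have [-> |u_neq0] := eqVneq u 0.
  by rewrite expr0n !mulr0 addr0 mulr_ge0// powR_ge0.
have p2 : 0 < 2 - p by lra.
have p1' : 0 < 1 - p by lra.
have cond : (2 - p)^-1 + ((2 - p) / (1 - p))^-1 = 1.
  by field; rewrite !gt_eqF.
have := conjugate_powR (mulr_ge0 c0 (powR_ge0 u (p / (2 - p))))
  (powR_ge0 u ((2 - 2 * p) / (2 - p))) p2 (divr_gt0 p2 p1') cond.
rewrite -mulrA -powRD; last by rewrite u_neq0 implybT.
rewrite (_ : p / (2 - p) + _ = 1); last by field; rewrite gt_eqF.
rewrite powRr1// powRM ?powR_ge0// -!powRrM.
rewrite (_ : p / (2 - p) * (2 - p) = p); last by field; rewrite gt_eqF.
rewrite (_ : (2 - 2 * p) / (2 - p) * ((2 - p) / (1 - p)) = 2%:R); last first.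
  by field; rewrite !gt_eqF.
rewrite powR_mulrn// => /(ler_wpM2l (ltW p2)) /le_trans; apply.
by rewrite le_eqVlt; apply/orP; left; apply/eqP; field; rewrite !gt_eqF.
Qed.

(** The right-hand side is the maximum over [a] of the left-hand side: here the
    constant of the theorem appears, as the value of a Legendre transform. *)
Lemma young_extremal (R : realType) (p a b : R) :
  0 < p -> p < 2 -> 0 <= a -> 0 <= b ->
  (2 * a) `^ (2 - p) * b - (2 - p) * a ^+ 2 <= p * 2 `^ (2 / p - 2) * b `^ (2 / p).
Proof.
move=> p0 p1 a0 b0.
have p2 : 0 < 2 - p by lra.
have cond : (2 / (2 - p))^-1 + (2 / p)^-1 = 1 by field; rewrite !gt_eqF.
have -> : (2 - p) * a ^+ 2 = (2 - p) / 4 * (2 * a) ^+ 2 by field.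
have {a0} : 0 <= 2 * a by rewrite mulr_ge0.
move: (2 * a) => {}a a0.
(* The factors [2^(-(2-p)/2)] and [2^((2-p)/2)] balance the two sides so that
   the quadratic term comes out with coefficient exactly [(2 - p) / 4]. *)
have := conjugate_powR
  (mulr_ge0 (powR_ge0 a (2 - p)) (powR_ge0 2 (- ((2 - p) / 2))))
  (mulr_ge0 b0 (powR_ge0 2 ((2 - p) / 2))) (divr_gt0 (ltr0Sn R 1) p2)
  (divr_gt0 (ltr0Sn R 1) p0) cond.
rewrite mulrACA -powRD; last by rewrite pnatr_eq0 implybT.
rewrite addNr powRr0 mulr1.
rewrite (powRM _ (powR_ge0 _ _) (powR_ge0 _ _)) (powRM _ b0 (powR_ge0 _ _)).
rewrite -!powRrM.
rewrite (_ : (2 - p) * (2 / (2 - p)) = 2%:R); last by field; rewrite gt_eqF.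
rewrite (_ : - ((2 - p) / 2) * (2 / (2 - p)) = -1%:R); last first.
  by field; rewrite gt_eqF.
rewrite (_ : (2 - p) / 2 * (2 / p) = 2 / p - 2 + 1); last by field; rewrite gt_eqF.
rewrite powR_mulrn// powR_invn// (@powRD _ 2 _ 1) ?pnatr_eq0 ?implybT// powRr1//.
rewrite lerBlDl => /le_trans; apply.
by rewrite le_eqVlt; apply/orP; left; apply/eqP; field; rewrite !gt_eqF.
Qed.

(** * Calculus of one real variable *)

Lemma powR_div (R : realType) (a b e : R) :
  0 <= a -> 0 < b -> (a / b) `^ e = a `^ e / b `^ e.
Proof.
move=> a0 b0; rewrite powRM// ?invr_ge0 ?(ltW b0)//; congr (_ * _).
by rewrite -(powR_inv1 (ltW b0)) -powRrM mulN1r powRN.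
Qed.

(** A bound that does not depend on the sign of the exponent: a power is
    monotone, so one of the two endpoint values already dominates. *)
Lemma powR_le_endpoints (R : realType) (e a b v : R) :
  0 < a -> a <= v <= b -> v `^ e <= a `^ e + b `^ e.
Proof.
move=> a0 /andP[av vb].
have v0 := lt_le_trans a0 av; have b0 := lt_le_trans v0 vb.
have [e0|e0] := leP 0 e.
  rewrite -[leLHS]add0r lerD ?powR_ge0//.
  by rewrite ge0_ler_powR ?nnegrE// ltW.
rewrite -[leLHS]addr0 lerD ?powR_ge0//.
rewrite -(opprK e) !(powRN _ (- e)) lef_pV2 ?posrE ?powR_gt0//.
by rewrite ge0_ler_powR ?nnegrE ?oppr_ge0 // ltW.
Qed.

Lemma affine_bounds (R : realType) (r s z : R) :
  `|s| <= r -> `|z| <= 1 -> 1 - r <= 1 + s * z <= 1 + r.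
Proof.
move=> sr z1; have : `|s * z| <= r.
  by rewrite normrM -[leRHS]mulr1 ler_pM.
by rewrite ler_norml => /andP[? ?]; apply/andP; split; lra.
Qed.

Lemma affine_gt0 (R : realType) (s z : R) :
  `|s| < 1 -> `|z| <= 1 -> 0 < 1 + s * z.
Proof.
by move=> s1 /(affine_bounds _ _ _ _ (lexx `|s|)) /andP[+ _]; lra.
Qed.

Lemma is_derive_powR_comp (R : realType) (f : R -> R) (e x a : R) :
  0 < f x -> is_derive x 1 f a ->
  is_derive x 1 (fun t => f t `^ e) (e * f x `^ (e - 1) * a).
Proof.
by move=> fx0 fa; have := is_derive1_comp (is_derive1_powR e fx0) fa.
Qed.

Lemma is_derive_within_continuous (R : realType) (f df : R -> R) (a b : R) :
  (forall x, a <= x <= b -> is_derive x 1 f (df x)) ->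
  {within `[a, b], continuous f}.
Proof.
move=> fdf; apply: derivable_within_continuous => x; rewrite in_itv/= => xab.
by have := fdf _ xab => -[].
Qed.

(** Two applications of the mean value theorem: the first bounds [f1] by an
    affine function, the second integrates that bound. *)
Lemma taylor2_le (R : realType) (f f1 f2 : R -> R) (K s : R) : 0 <= s ->
  (forall x, 0 <= x <= s -> is_derive x 1 f (f1 x)) ->
  (forall x, 0 <= x <= s -> is_derive x 1 f1 (f2 x)) ->
  (forall x, 0 <= x <= s -> f2 x <= K) ->
  f s <= f 0 + f1 0 * s + K / 2 * s ^+ 2.
Proof.
move=> s0 ff1 ff2 f2K.
have f1_le x : 0 <= x <= s -> f1 x <= f1 0 + K * x.
  move=> /andP[x0 xs].
  have sub y : 0 <= y <= x -> 0 <= y <= s.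
    by move=> /andP[-> yx]; rewrite (le_trans yx).
  have [||c] := @MVT_segment R f1 f2 0 x x0.
  - move=> y; rewrite in_itv/= => /andP[y0 yx].
    by apply: ff2; apply: sub; rewrite !ltW.
  - by apply: (@is_derive_within_continuous _ _ f2) => y /sub /ff2.
  rewrite in_itv/= => /sub /f2K cK; rewrite subr0 => H.
  by rewrite -lerBlDl H ler_wpM2r.
pose h x := f x - f1 0 * x - K / 2 * x ^+ 2.
have hd x : 0 <= x <= s -> is_derive x 1 h (f1 x - f1 0 - K * x).
  move=> /ff1 fx.
  have -> : h = f - (f1 0 \*: id) - ((K / 2) \*: (id ^+ 2)).
    by apply/funext => y; rewrite /h !fctE /= expr2.
  apply: is_derive_eq.
  by rewrite /GRing.scale/= expr1 -mulr_natl; field.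
have [||c] := @MVT_segment R h (fun x => f1 x - f1 0 - K * x) 0 s s0.
- move=> x; rewrite in_itv/= => /andP[x0 xs]; apply: hd; rewrite !ltW//.
- exact: (@is_derive_within_continuous _ _ _ _ _ hd).
rewrite in_itv/= => /f1_le cK; rewrite subr0 /h => H.
suff : (f1 c - f1 0 - K * c) * s <= 0.
  by rewrite -H; lra.
by rewrite mulr_le0_ge0//; lra.
Qed.

(** * Integrals of powers of an affine function *)

Lemma measurable_powR_comp (R : realType) d (T : measurableType d)
    (B : set T) (e : R) (f : T -> R) :
  measurable_fun B f -> measurable_fun B (fun t => f t `^ e).
Proof. exact: (@measurableT_comp _ _ _ _ _ _ (@powR R ^~ e) _ f). Qed.

Lemma integrable_scale (R : realType) d (T : measurableType d)
    (mu : {measure set T -> \bar R}) (B : set T) (k : R) (f : T -> R) :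
  measurable B -> mu.-integrable B (EFin \o f) ->
  mu.-integrable B (EFin \o (fun t => k * f t)).
Proof.
move=> mB fi.
have -> : EFin \o (fun t => k * f t) = (fun t => k%:E * (EFin \o f) t)%E.
  by apply/funext => t /=; rewrite EFinM.
exact: integrableZl.
Qed.

Lemma integrableM_le1 (R : realType) d (T : measurableType d)
    (mu : {measure set T -> \bar R}) (B : set T) (g h : T -> R) :
  measurable B -> mu.-integrable B (EFin \o g) -> measurable_fun B h ->
  (forall t, B t -> `|h t| <= 1) ->
  mu.-integrable B (EFin \o (fun t => g t * h t)).
Proof.
move=> mB ig mh h1.
have -> : EFin \o (fun t => g t * h t) = ((EFin \o g) \* (EFin \o h))%E.
  by apply/funext => t /=; rewrite EFinM.
apply: integrableMl => //; exists 1; split; first exact: num_real.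
by move=> M ltM t Bt /=; rewrite (le_trans _ (ltW ltM))// h1.
Qed.

Lemma measurable_affine_powR (R : realType) d (T : measurableType d)
    (B : set T) (z : T -> R) (e s : R) :
  measurable_fun B z -> measurable_fun B (fun t => (1 + s * z t) `^ e).
Proof.
move=> mz; apply: measurable_powR_comp.
by apply: measurable_funD => //; apply: measurable_funM.
Qed.

Lemma integrable_affine_powR (R : realType) d (T : measurableType d)
    (mu : {measure set T -> \bar R}) (B : set T) (g z : T -> R) (e s : R) :
  measurable B -> mu.-integrable B (EFin \o g) -> measurable_fun B z ->
  (forall t, B t -> `|z t| <= 1) -> `|s| < 1 ->
  mu.-integrable B (EFin \o (fun t => g t * (1 + s * z t) `^ e)).
Proof.
move=> mB ig mz z1 s1.
have -> : EFin \o (fun t => g t * (1 + s * z t) `^ e) =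
    ((EFin \o g) \* (EFin \o (fun t => (1 + s * z t) `^ e)%R))%E.
  by apply/funext => t /=; rewrite EFinM.
apply: integrableMl => //; first exact: measurable_affine_powR.
exists ((1 - `|s|) `^ e + (1 + `|s|) `^ e); split; first exact: num_real.
move=> M ltM t Bt; rewrite /= ger0_norm ?powR_ge0// (le_trans _ (ltW ltM))//.
by rewrite powR_le_endpoints ?subr_gt0//; apply: affine_bounds => //; exact: z1.
Qed.

(** Near [s] the parameter stays in [`]-r, r[] with [r < 1], so [1 + x z] stays
    in the compact interval [[1 - r, 1 + r]] away from [0] and the derivative of
    the integrand is dominated by a multiple of [`|g|].  The derivative is again
    an integral of the same form, so the lemma can be iterated. *)
Lemma is_derive_integral_affine_powR (R : realType) d (T : measurableType d)
    (mu : {measure set T -> \bar R}) (B : set T) (g z : T -> R) (e s : R) :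
  measurable B -> mu.-integrable B (EFin \o g) -> measurable_fun B z ->
  (forall t, B t -> `|z t| <= 1) -> `|s| < 1 ->
  is_derive s 1 (fun x : R => \int[mu]_(t in B) (g t * (1 + x * z t) `^ e))
    (e * \int[mu]_(t in B) (g t * z t * (1 + s * z t) `^ (e - 1))).
Proof.
move=> mB ig mz z1 s1.
pose f (x : R) t := g t * (1 + x * z t) `^ e.
(* Any [r] strictly between [`|s|] and [1] would do. *)
pose r := (1 + `|s|) / 2.
have r1 : r < 1 by rewrite /r; lra.
have itvP (x : R) : x \in `](- r), r[ -> `|x| < r.
  by rewrite in_itv/= ltr_norml.
have sr : s \in `](- r), r[.
  by rewrite in_itv/= -ltr_norml /r; lra.
have intf (x : R) : x \in `](- r), r[ -> mu.-integrable B (EFin \o f x).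
  by move=> /itvP xr; apply: integrable_affine_powR => //; rewrite (lt_trans xr).
have igz := integrableM_le1 _ _ _ _ _ _ _ mB ig mz z1.
have df (x : R) t : x \in `](- r), r[ -> B t ->
    is_derive x 1 (f ^~ t) (e * (g t * z t * (1 + x * z t) `^ (e - 1))).
  move=> /itvP xr Bt.
  have da : is_derive x 1 (fun y : R => 1 + y * z t) (z t).
    have -> : (fun y : R => 1 + y * z t) = cst 1 + (z t \*: id).
      by apply/funext => y; rewrite !fctE /= /GRing.scale/= mulrC.
    by apply: is_derive_eq; rewrite /GRing.scale/= add0r mulr1.
  have v0 : 0 < 1 + x * z t by apply: affine_gt0; [rewrite (lt_trans xr)|exact: z1].
  have dp := @is_derive_powR_comp R (fun y : R => 1 + y * z t) e x _ v0 da.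
  have -> : f ^~ t = g t \*: (fun y : R => (1 + y * z t) `^ e).
    by apply/funext => y.
  by apply: is_derive_eq; rewrite /GRing.scale/=; ring.
pose K := `|e| * ((1 - r) `^ (e - 1) + (1 + r) `^ (e - 1)).
have K0 : 0 <= K by rewrite mulr_ge0// addr_ge0// powR_ge0.
pose G t := K * `|g t|.
have intG : mu.-integrable B (EFin \o G).
  by apply: integrable_scale => //; exact: integrable_norm.
have G_ub (x : R) t : x \in `](- r), r[ -> B t -> `|partial1of2 f x t| <= G t.
  move=> Ix Bt; have dft := df _ _ Ix Bt.
  rewrite partial1of2E derive_val /G /K !normrM -!mulrA ler_wpM2l//.
  rewrite [leRHS]mulrC ler_wpM2l// (ger0_norm (powR_ge0 _ _)).
  rewrite -[leRHS]mul1r ler_pM ?powR_ge0 ?z1//.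
  apply: powR_le_endpoints; first by rewrite subr_gt0.
  by apply: affine_bounds; [exact/ltW/itvP|exact: z1].
have derf (x : R) t : x \in `](- r), r[ -> B t -> derivable (f ^~ t) x 1.
  by move=> Ix Bt; have [] := df _ _ Ix Bt.
have G0 t : 0 <= G t by rewrite mulr_ge0.
apply: DeriveDef.
  exact: (derivable_under_integral mB sr intf derf G0 intG G_ub).
rewrite -derive1E (differentiation_under_integral mB sr intf derf G0 intG G_ub).
rewrite -RintegralZl//; last exact: integrable_affine_powR.
apply: eq_Rintegral => t /set_mem Bt; have dft := df _ _ sr Bt.
by rewrite partial1of2E derive_val.
Qed.

(** * The inequality for weighted integrals *)

(** With [u = |z| / (1 + s z)], the left-hand side is half of the second
    derivative of [S^(2/p)] along the segment when [z] has constant sign, and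
    dominates it in general.  With [a = A / S], Young's
    interpolation inequality at [c = 2 a] bounds it by
    [S^(2/p) ((2 a)^(2-p) D / S - (2 - p) a^2)], and young_extremal applies with
    [b = D / S]. *)
Lemma integral_second_variation_le (R : realType) d (T : measurableType d)
    (mu : {measure set T -> \bar R}) (B : set T) (p : R) (W u : T -> R) :
  0 < p -> p < 1 -> measurable B ->
  (forall t, B t -> 0 <= W t) -> (forall t, B t -> 0 <= u t) ->
  mu.-integrable B (EFin \o W) ->
  mu.-integrable B (EFin \o (fun t => W t * u t)) ->
  mu.-integrable B (EFin \o (fun t => W t * u t ^+ 2)) ->
  mu.-integrable B (EFin \o (fun t => W t * u t `^ p)) ->
  0 < \int[mu]_(t in B) W t ->
  (2 - p) * (\int[mu]_(t in B) (W t * u t)) ^+ 2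
    * (\int[mu]_(t in B) W t) `^ (2 / p - 2)
  - (1 - p) * \int[mu]_(t in B) (W t * u t ^+ 2)
    * (\int[mu]_(t in B) W t) `^ (2 / p - 1)
  <= p * 2 `^ (2 / p - 2) * (\int[mu]_(t in B) (W t * u t `^ p)) `^ (2 / p).
Proof.
move=> p0 p1 mB W0 u0 iW iWu iWu2 iWup.
set S := \int[mu]_(t in B) W t; set A := \int[mu]_(t in B) (W t * u t).
set Q := \int[mu]_(t in B) _; set D := \int[mu]_(t in B) _ => S0.
have A0 : 0 <= A by apply: Rintegral_ge0 => t Bt; rewrite mulr_ge0 ?W0 ?u0.
have D0 : 0 <= D by apply: Rintegral_ge0 => t Bt; rewrite mulr_ge0 ?W0 ?powR_ge0.
have Sn : S != 0 by rewrite gt_eqF.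
pose a := A / S.
have a0 : 0 <= a by rewrite divr_ge0 // ltW.
(* The parameter [2 a] is dictated by the equality case: if [u = c] on half of
   the total weight and [u = 0] elsewhere, then [c = 2 A / S]. *)
have young_int : (2 - p) * (2 * a) * A <= (2 * a) `^ (2 - p) * D + (1 - p) * Q.
  rewrite -!RintegralZl// -RintegralD//; try exact: integrable_scale.
  apply: le_Rintegral => //.
  - exact: integrable_scale.
  - have -> : EFin \o (fun t => (2 * a) `^ (2 - p) * (W t * u t `^ p) +
          (1 - p) * (W t * u t ^+ 2)) =
        ((EFin \o (fun t => ((2 * a) `^ (2 - p) * (W t * u t `^ p))%R)) \+
         (EFin \o (fun t => ((1 - p) * (W t * u t ^+ 2))%R)))%E.
      by apply/funext => t /=; rewrite EFinD.
    by apply: integrableD => //; exact: integrable_scale.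
  - move=> t Bt.
    have := young_interpolation _ p _ _ p1 (mulr_ge0 (ler0n R 2) a0) (u0 t Bt).
    by move=> /(ler_wpM2l (W0 t Bt)); congr (_ <= _); ring.
have SP : S `^ (2 / p) != 0 by rewrite gt_eqF ?powR_gt0.
have := young_extremal _ _ _ _ p0 (ltac:(lra) : p < 2) a0 (divr_ge0 D0 (ltW S0)).
rewrite (powR_div _ _ _ _ D0 S0) => /(ler_wpM2r (powR_ge0 S (2 / p))).
rewrite -[leRHS]mulrA mulfVK//; apply: le_trans.
have -> : S `^ (2 / p - 2) = S `^ (2 / p) / S ^+ 2.
  by rewrite powRB ?Sn ?implybT// powR_mulrn// ltW.
have -> : S `^ (2 / p - 1) = S `^ (2 / p) / S.
  by rewrite powRB ?Sn ?implybT// powRr1// ltW.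
have SP0 : 0 <= S `^ (2 / p) / S by rewrite divr_ge0 ?powR_ge0// ltW.
have AE : A = a * S by rewrite /a mulfVK.
have {}young_int := mulr_ge0 SP0 (etrans (subr_ge0 _ _) young_int).
rewrite -subr_ge0 (le_trans young_int)// le_eqVlt; apply/orP; left; apply/eqP.
by rewrite AE; field; rewrite Sn.
Qed.

(** Taylor's inequality for [F = S^(2/p)] on [[0, s]], with [F''] bounded by
    integral_second_variation_le.  The bound holds with the same constant at
    every point of the segment, because [D] does not involve the base point. *)
Lemma weighted_smoothness (R : realType) d (T : measurableType d)
    (mu : {measure set T -> \bar R}) (B : set T) (p s : R) (w z : T -> R) :
  0 < p -> p < 1 -> measurable B ->
  (forall t, B t -> 0 < w t) -> (forall t, B t -> `|z t| <= 1) ->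
  mu.-integrable B (EFin \o w) -> measurable_fun B z ->
  0 < \int[mu]_(t in B) w t -> 0 <= s < 1 ->
  (\int[mu]_(t in B) (w t * (1 + s * z t) `^ p)) `^ (2 / p) <=
  (\int[mu]_(t in B) w t) `^ (2 / p)
  + 2 * ((\int[mu]_(t in B) w t) `^ (2 / p - 1) *
         \int[mu]_(t in B) (w t * z t)) * s
  + p * 2 `^ (2 / p - 2) * (\int[mu]_(t in B) (w t * `|z t| `^ p)) `^ (2 / p)
    * s ^+ 2.
Proof.
move=> p0 p1 mB w0 z1 iw mz I0 /andP[s0 s1].
have pn : p != 0 by rewrite gt_eqF.
have iwz := integrableM_le1 _ _ _ _ _ _ _ mB iw mz z1.
have iwzz := integrableM_le1 _ _ _ _ _ _ _ mB iwz mz z1.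
have mzn : measurable_fun B (fun t => `|z t|) by exact: measurableT_comp.
have z1n t : B t -> `| `|z t| | <= 1 by move=> Bt; rewrite normr_id z1.
have iwzn := integrableM_le1 _ _ _ _ _ _ _ mB iw mzn z1n.
have mzp : measurable_fun B (fun t => `|z t| `^ p).
  exact: measurable_powR_comp.
have z1p t : B t -> `| `|z t| `^ p| <= 1.
  move=> Bt; rewrite ger0_norm ?powR_ge0//.
  apply: (@le_trans _ _ (1 `^ p)); last by rewrite powR1.
  by rewrite ge0_ler_powR ?nnegrE ?z1// ltW.
have iwzp := integrableM_le1 _ _ _ _ _ _ _ mB iw mzp z1p.
pose S x := \int[mu]_(t in B) (w t * (1 + x * z t) `^ p).
pose A x := \int[mu]_(t in B) (w t * z t * (1 + x * z t) `^ (p - 1)).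
pose Q x := \int[mu]_(t in B) (w t * z t * z t * (1 + x * z t) `^ (p - 1 - 1)).
have S00 : S 0 = \int[mu]_(t in B) w t.
  by apply: eq_Rintegral => t _; rewrite mul0r addr0 powR1 mulr1.
have A00 : A 0 = \int[mu]_(t in B) (w t * z t).
  by apply: eq_Rintegral => t _; rewrite mul0r addr0 powR1 mulr1.
have x1 x : 0 <= x <= s -> `|x| < 1.
  by move=> /andP[x0 xs]; rewrite ger0_norm// (le_lt_trans xs).
have v0 x t : 0 <= x <= s -> B t -> 0 < 1 + x * z t.
  by move=> xs Bt; apply: affine_gt0; [exact: x1|exact: z1].
have S0 x : 0 <= x <= s -> 0 < S x.
  move=> xs.
  have c0 : 0 < (1 - s) `^ p by apply: powR_gt0; rewrite subr_gt0.
  rewrite (lt_le_trans (mulr_gt0 c0 I0))// -RintegralZl//.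
  apply: le_Rintegral => //.
  - exact: integrable_scale.
  - by apply: integrable_affine_powR => //; exact: x1.
  - move=> t Bt; rewrite mulrC ler_wpM2l ?(ltW (w0 _ Bt))//.
    have xs' : `|x| <= s by case/andP: xs => ? ?; rewrite ger0_norm.
    have /andP[h _] := affine_bounds _ _ _ _ xs' (z1 _ Bt).
    rewrite ge0_ler_powR ?nnegrE ?(ltW p0)//; last exact/ltW/v0.
    by rewrite subr_ge0 ltW.
have dS x : 0 <= x <= s -> is_derive x 1 S (p * A x).
  by move=> xs; apply: is_derive_integral_affine_powR => //; exact: x1.
have dA x : 0 <= x <= s -> is_derive x 1 A ((p - 1) * Q x).
  by move=> xs; apply: is_derive_integral_affine_powR => //; exact: x1.
pose F x := S x `^ (2 / p).
pose F1 x := 2 * (S x `^ (2 / p - 1) * A x).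
pose F2 x := 2 * ((2 - p) * A x ^+ 2 * S x `^ (2 / p - 2)
                  - (1 - p) * Q x * S x `^ (2 / p - 1)).
have dF x : 0 <= x <= s -> is_derive x 1 F (F1 x).
  move=> xs; have dp := is_derive_powR_comp _ S (2 / p) _ _ (S0 _ xs) (dS _ xs).
  by apply: is_derive_eq; rewrite /F1; field.
have dF1 x : 0 <= x <= s -> is_derive x 1 F1 (F2 x).
  move=> xs; have dp := is_derive_powR_comp _ S (2 / p - 1) _ _ (S0 _ xs) (dS _ xs).
  have dAx := dA _ xs.
  have -> : F1 = 2 \*: ((fun t => S t `^ (2 / p - 1)) * A) by apply/funext.
  apply: is_derive_eq.
  rewrite /GRing.scale/= /F2 (_ : 2 / p - 1 - 1 = 2 / p - 2); last by ring.
  by field.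
pose D := \int[mu]_(t in B) (w t * `|z t| `^ p).
have F2_le x : 0 <= x <= s -> F2 x <= 2 * (p * 2 `^ (2 / p - 2) * D `^ (2 / p)).
  move=> xs; rewrite /F2 ler_wpM2l//.
  pose W t := w t * (1 + x * z t) `^ p.
  pose u t := `|z t| / (1 + x * z t).
  have Wu t : B t -> W t * u t = w t * `|z t| * (1 + x * z t) `^ (p - 1).
    move=> Bt; have v := v0 _ _ xs Bt.
    have vn := lt0r_neq0 v.
    by rewrite /W /u powRB ?vn ?implybT// powRr1 ?(ltW v)//; ring.
  have Wu2 t : B t -> W t * u t ^+ 2 = w t * z t * z t * (1 + x * z t) `^ (p - 1 - 1).
    move=> Bt; have v := v0 _ _ xs Bt.
    have vn := lt0r_neq0 v.
    rewrite expr_div_n real_normK ?num_real// -addrA -opprD -[1 + 1]/(2%:R).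
    rewrite (@powRB _ _ p 2%:R) ?vn ?implybT// powR_mulrn ?(ltW v)// /W.
    by field.
  have Wup t : B t -> W t * u t `^ p = w t * `|z t| `^ p.
    move=> Bt; have v := v0 _ _ xs Bt; have vp := powR_gt0 p v.
    by rewrite /u /W powR_div//; field; rewrite gt_eqF.
  have iWu : mu.-integrable B (EFin \o (fun t => W t * u t)).
    apply: (@eq_integrable _ _ _ _ _ mB
      (EFin \o (fun t => w t * `|z t| * (1 + x * z t) `^ (p - 1)))).
      by move=> t /set_mem Bt /=; rewrite Wu.
    by apply: integrable_affine_powR => //; exact: x1.
  have iWu2 : mu.-integrable B (EFin \o (fun t => W t * u t ^+ 2)).
    apply: (@eq_integrable _ _ _ _ _ mB
      (EFin \o (fun t => w t * z t * z t * (1 + x * z t) `^ (p - 1 - 1)))).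
      by move=> t /set_mem Bt /=; rewrite Wu2.
    by apply: integrable_affine_powR => //; exact: x1.
  have iWup : mu.-integrable B (EFin \o (fun t => W t * u t `^ p)).
    apply: (@eq_integrable _ _ _ _ _ mB (EFin \o (fun t => w t * `|z t| `^ p))) => //.
    by move=> t /set_mem Bt /=; rewrite Wup.
  have iW : mu.-integrable B (EFin \o W).
    by apply: integrable_affine_powR => //; exact: x1.
  have W0 t : B t -> 0 <= W t.
    by move=> Bt; rewrite mulr_ge0 ?powR_ge0// ltW// w0.
  have u0 t : B t -> 0 <= u t.
    by move=> Bt; rewrite divr_ge0// ltW// v0.
  have := integral_second_variation_le _ _ _ _ _ _ _ _ p0 p1 mB W0 u0 iW iWu
    iWu2 iWup (S0 _ xs).
  have -> : \int[mu]_(t in B) (W t * u t ^+ 2) = Q x.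
    by apply: eq_Rintegral => t /set_mem Bt; rewrite Wu2.
  have -> : \int[mu]_(t in B) (W t * u t `^ p) = D.
    by apply: eq_Rintegral => t /set_mem Bt; rewrite Wup.
  (* [A x] is an integral of [z], not of [|z|]: its square is bounded by the
     square of the integral of [W u]. *)
  apply: le_trans; rewrite lerD2r ler_wpM2r ?powR_ge0// ler_wpM2l//; first by lra.
  rewrite -[leLHS]real_normK ?num_real// lerXn2r ?nnegrE//.
    by apply: Rintegral_ge0 => t Bt; rewrite mulr_ge0 ?W0 ?u0.
  rewrite (le_trans (le_normr_Rintegral _ _))//.
    by apply: integrable_affine_powR => //; exact: x1.
  rewrite le_eqVlt; apply/orP; left; apply/eqP.
  apply: eq_Rintegral => t /set_mem Bt; rewrite Wu// !normrM.
  by rewrite (gtr0_norm (w0 _ Bt)) (ger0_norm (powR_ge0 _ _)).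
have := taylor2_le _ F F1 F2 _ _ s0 dF dF1 F2_le.
rewrite /F /F1 S00 A00 => /le_trans; apply.
by rewrite le_eqVlt; apply/orP; left; apply/eqP; rewrite /D; field.
Qed.

(** Passage to the limit [s -> 1], done with an explicit [s]: if the conclusion
    failed by [delta], the hypothesis would fail at [1 - eps], [eps] being of
    order [delta] divided by the size of the coefficients. *)
Lemma quadratic_le_at1 (R : realType) (a b c d : R) :
  (forall s, 0 <= s < 1 -> s ^+ 2 * a <= b + c * s + d * s ^+ 2) -> a <= b + c + d.
Proof.
move=> H; rewrite leNgt; apply/negP => lt_a.
pose delta := a - (b + c + d).
have d0 : 0 < delta by rewrite subr_gt0.
pose M := 2 * `|a - d| + `|c| + delta.
have M0 : 0 < M by rewrite /M ltr_wpDl// addr_ge0// mulr_ge0.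
pose eps := delta / (2 * M).
have eM : eps * M = delta / 2 by rewrite /eps; field; rewrite gt_eqF.
have e0 : 0 < eps by rewrite divr_gt0// mulr_gt0.
have e1 : eps <= 1 / 2.
  rewrite ler_pdivrMr ?mulr_gt0//.
  have : delta <= M by rewrite lerDr addr_ge0// mulr_ge0.
  lra.
have s01 : 0 <= 1 - eps < 1 by apply/andP; split; lra.
have := H _ s01.
apply/negP; rewrite -ltNge -subr_gt0.
have ad : - `|a - d| <= a - d <= `|a - d| by rewrite -ler_norml.
have cc : - `|c| <= c <= `|c| by rewrite -ler_norml.
have h1 : (a - d) * (2 * eps - eps ^+ 2) <= `|a - d| * (2 * eps).
  rewrite (@le_trans _ _ (`|a - d| * (2 * eps - eps ^+ 2)))//.
    by apply: ler_wpM2r; [nra|case/andP: ad].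
  by apply: ler_wpM2l => //; nra.
have h2 : - c * eps <= `|c| * eps.
  by apply: ler_wpM2r; [lra|case/andP: cc; lra].
have h3 : 2 * `|a - d| * eps + `|c| * eps = delta / 2 - delta * eps.
  by rewrite -eM /M; ring.
have h4 : 0 < delta * eps by rewrite mulr_gt0.
rewrite (_ : _ - _ = delta - (a - d) * (2 * eps - eps ^+ 2) + c * eps); last first.
  by rewrite /delta; ring.
lra.
Qed.

(** At [s = 1] the factor [1 + z] may vanish and [F] need not be
    differentiable there.  Since [1 + s z >= s (1 + z)], the left-hand side at
    [s] is at least [s^2] times its value at [1], and [s] can tend to [1]. *)
Lemma weighted_smoothness1 (R : realType) d (T : measurableType d)
    (mu : {measure set T -> \bar R}) (B : set T) (p : R) (w z : T -> R) :
  0 < p -> p < 1 -> measurable B ->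
  (forall t, B t -> 0 < w t) -> (forall t, B t -> `|z t| <= 1) ->
  mu.-integrable B (EFin \o w) -> measurable_fun B z ->
  0 < \int[mu]_(t in B) w t ->
  (\int[mu]_(t in B) (w t * (1 + z t) `^ p)) `^ (2 / p) <=
  (\int[mu]_(t in B) w t) `^ (2 / p)
  + 2 * ((\int[mu]_(t in B) w t) `^ (2 / p - 1) *
         \int[mu]_(t in B) (w t * z t))
  + p * 2 `^ (2 / p - 2) * (\int[mu]_(t in B) (w t * `|z t| `^ p)) `^ (2 / p).
Proof.
move=> p0 p1 mB w0 z1 iw mz I0; apply: quadratic_le_at1 => s s01.
apply: (le_trans _ (weighted_smoothness _ _ _ _ _ _ s _ _ p0 p1 mB w0 z1 iw mz I0 s01)).
have /andP[s0 s1] := s01.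
have zB t : B t -> -1 <= z t <= 1 by move=> Bt; rewrite -ler_norml z1.
have h0 t : B t -> 0 <= (1 + z t) / 2 by move=> /zB; lra.
(* Halving [1 + z] brings it into [[0, 1]], so that integrableM_le1 applies. *)
have mh : measurable_fun B (fun t => ((1 + z t) / 2) `^ p).
  by apply: measurable_powR_comp; apply: measurable_funM => //; apply: measurable_funD.
have h1 t : B t -> `|((1 + z t) / 2) `^ p| <= 1.
  move=> Bt; rewrite ger0_norm ?powR_ge0//.
  apply: (@le_trans _ _ (1 `^ p)); last by rewrite powR1.
  by rewrite ge0_ler_powR ?nnegrE ?h0 ?(ltW p0)//; have := zB _ Bt; lra.
have iwh := integrableM_le1 _ _ _ _ _ _ _ mB iw mh h1.
have iZ k := integrable_scale _ _ _ _ _ k _ mB iwh.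
have -> : \int[mu]_(t in B) (w t * (1 + z t) `^ p) =
    \int[mu]_(t in B) (2 `^ p * (w t * ((1 + z t) / 2) `^ p)).
  apply: eq_Rintegral => t /set_mem Bt.
  rewrite powR_div//; last by have := zB _ Bt; lra.
  by field; rewrite gt_eqF// powR_gt0.
have -> : s ^+ 2 = (s `^ p) `^ (2 / p).
  by rewrite -powRrM (_ : p * (2 / p) = 2%:R) ?powR_mulrn//; field; rewrite gt_eqF.
have Ige : 0 <= \int[mu]_(t in B) (2 `^ p * (w t * ((1 + z t) / 2) `^ p)).
  apply: Rintegral_ge0 => t Bt.
  by rewrite !mulr_ge0 ?powR_ge0// (ltW (w0 _ Bt)).
rewrite -powRM ?powR_ge0//; apply: ge0_ler_powR.
- by rewrite divr_ge0// ltW.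
- by rewrite nnegrE mulr_ge0 ?powR_ge0.
- rewrite nnegrE; apply: Rintegral_ge0 => t Bt.
  by rewrite !mulr_ge0 ?powR_ge0// (ltW (w0 _ Bt)).
rewrite -RintegralZl//.
apply: le_Rintegral => //.
- under eq_fun do rewrite mulrA.
  exact: iZ.
- by apply: integrable_affine_powR => //; rewrite ger0_norm.
move=> t Bt; have zt := zB _ Bt.
have -> : s `^ p * (2 `^ p * (w t * ((1 + z t) / 2) `^ p)) =
    w t * (s * (1 + z t)) `^ p.
  rewrite powR_div//; last by lra.
  rewrite powRM//; last by lra.
  by field; rewrite gt_eqF// powR_gt0.
rewrite ler_wpM2l ?(ltW (w0 _ Bt))//.
by rewrite ge0_ler_powR ?nnegrE ?(ltW p0)//; nra.
Qed.

(** * The quasi-norm as an integral over a set *)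

(** When the integral is infinite, so is the extended-real quasi-norm, and both
    sides are [0] by the conventions for [fine] and for powers of [0]. *)
Lemma Lp_norm_support (R : realType) d (T : measurableType d)
    (mu : {measure set T -> \bar R}) (B : set T) (p : R) (f : T -> R) :
  measurable B -> measurable_fun [set: T] f ->
  {ae mu, forall t, ~ B t -> f t = 0} -> 0 < p ->
  Lp_norm mu p f = (\int[mu]_(t in B) (`|f t| `^ p)) `^ p^-1.
Proof.
move=> mB mf f0 p0.
have mfp : measurable_fun [set: T] (fun t => (`|f t| `^ p)%:E).
  by apply/measurable_EFinP/measurable_powR_comp; exact: measurableT_comp.
rewrite /Lp_norm unlock /Rintegral.
have -> : (\int[mu]_t (`|(EFin \o f) t| `^ p) = \int[mu]_(t in B) (`|f t| `^ p)%:E)%E.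
  rewrite [RHS]integral_mkcond; apply: ge0_ae_eq_integral => //.
  - by apply/(measurable_restrictT _ mB); apply: measurable_funTS.
  - by move=> t _; rewrite poweR_ge0.
  - by move=> t _; rewrite patchE; case: ifPn => // _; rewrite lee_fin powR_ge0.
  - apply: filterS f0 => t ft _; rewrite patchE /=; case: ifPn => //.
    by rewrite notin_setE => /ft /= ->; rewrite /= normr0 powR0// gt_eqF.
have : (0 <= \int[mu]_(t in B) (`|f t| `^ p)%:E)%E.
  by apply: integral_ge0 => t _; rewrite lee_fin powR_ge0.
case: (\int[mu]_(t in B) _)%E => [r r0||//].
  by rewrite poweR_EFin.
by move=> _; rewrite /= invr_eq0 (gt_eqF p0)/= powR0// invr_eq0 gt_eqF.
Qed.

Lemma Lfun_measurable_finite (R : realType) d (T : measurableType d)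
    (mu : {measure set T -> \bar R}) (p : \bar R) (f : T -> R) :
  f \in Lfun mu p ->
  measurable_fun [set: T] f /\ ('N[mu]_p[EFin \o f] < +oo)%E.
Proof. by rewrite inE => /andP[/[!inE]/= mf]. Qed.

Lemma Lfun_integrable_powR (R : realType) d (T : measurableType d)
    (mu : {measure set T -> \bar R}) (p : R) (f : T -> R) :
  0 < p -> f \in Lfun mu p%:E ->
  mu.-integrable [set: T] (EFin \o (fun t => `|f t| `^ p)).
Proof.
move=> p0 /Lfun_measurable_finite[mf Nf].
apply/integrableP; split.
  by apply/measurable_EFinP/measurable_powR_comp; exact: measurableT_comp.
have -> : (\int[mu]_t `|(EFin \o (fun t => (`|f t| `^ p)%R)) t| =
    'N[mu]_(p%:E)[EFin \o f] `^ p)%E.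
  rewrite poweR_Lnorm ?gt_eqF//; apply: eq_integral => t _ /=.
  by rewrite ger0_norm ?powR_ge0.
exact: poweR_lty.
Qed.

Lemma Lp_norm_eq0 (R : realType) d (T : measurableType d)
    (mu : {measure set T -> \bar R}) (p : R) (f : T -> R) :
  0 < p -> f \in Lfun mu p%:E -> Lp_norm mu p f = 0 ->
  {ae mu, forall t, f t = 0}.
Proof.
move=> p0 /Lfun_measurable_finite[mf Nf] N0.
have : ('N[mu]_(p%:E)[EFin \o f] = 0)%E.
  have Nfin : ('N[mu]_(p%:E)[EFin \o f] \is a fin_num)%E.
    by rewrite ge0_fin_numE// Lnorm_ge0.
  by rewrite -(fineK Nfin) -/(Lp_norm mu p f) N0.
have mfE : measurable_fun [set: T] (EFin \o f) by exact/measurable_EFinP.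
move=> /(Lnorm_eq0_eq0 mfE); rewrite lte_fin => /(_ p0).
by apply: filterS => t /(_ I) /= [].
Qed.

Lemma Lp_norm_ae0 (R : realType) d (T : measurableType d)
    (mu : {measure set T -> \bar R}) (p : R) (f : T -> R) :
  0 < p -> measurable_fun [set: T] f -> {ae mu, forall t, f t = 0} ->
  Lp_norm mu p f = 0.
Proof.
move=> p0 mf f0; rewrite (Lp_norm_support _ _ _ _ set0)//.
  by rewrite Rintegral_set0 powR0// invr_eq0 gt_eqF.
by apply: filterS f0.
Qed.

(** * Validity of the constant *)

(** Reduction to weighted_smoothness1 with [w = x^p] and [z = y / x] on
    [B = {x > 0, |y| <= x}].  The two sign hypotheses say that [|y| <= x] almost
    everywhere, so [x] and [y] vanish almost everywhere off [B]. *)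
Lemma cone_smooth_with_sharp (R : realType) (p : R) :
  0 < p -> p < 1 -> cone_smooth_with p (p * 2 `^ (2 / p - 2)).
Proof.
move=> p0 p1 d T mu x y Lx Ly xy_ge0 xy_ge0'.
have pn : p != 0 by rewrite gt_eqF.
have mx : measurable_fun [set: T] x by have [] := Lfun_measurable_finite _ _ _ _ _ _ Lx.
have my : measurable_fun [set: T] y by have [] := Lfun_measurable_finite _ _ _ _ _ _ Ly.
have mxy : measurable_fun [set: T] (x \+ y) by exact: measurable_funD.
have [x_eq0|x_neq0] := pselect {ae mu, forall t, x t = 0}.
  have -> : Lp_norm mu p (x \+ y) = 0.
    apply: Lp_norm_ae0 => //; move: x_eq0 xy_ge0 xy_ge0'; apply: filterS3 => t /= ->.
    by rewrite add0r sub0r oppr_ge0 => y0 y0'; apply/eqP; rewrite eq_le y0 y0'.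
  rewrite /cone_tangent; case: asboolP => // _.
  rewrite expr0n/= mulr0 addr0 addr_ge0 ?sqr_ge0// mulr_ge0 ?sqr_ge0//.
  by rewrite mulr_ge0 ?powR_ge0// ltW.
pose B := [set t | 0 < x t /\ 0 <= x t - `|y t|].
have mB : measurable B.
  have -> : B = (x @^-1` `]0, +oo[) `&` ((fun t => x t - `|y t|) @^-1` `[0, +oo[).
    by apply/seteqP; split => t /=; rewrite !in_itv/= !andbT.
  apply: measurableI; rewrite -[X in measurable X]setTI.
    exact: mx.
  have : measurable_fun [set: T] (fun t => x t - `|y t|).
    by apply: measurable_funB => //; exact: measurableT_comp.
  exact.
have offB : {ae mu, forall t, ~ B t -> x t = 0 /\ y t = 0}.
  move: xy_ge0 xy_ge0'; apply: filterS2 => t h1 h2 nB.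
  have yx : `|y t| <= x t by rewrite ler_norml; apply/andP; split; lra.
  have xt : x t = 0.
    apply/eqP; rewrite eq_le (le_trans _ yx)// andbT leNgt; apply/negP => xt.
    by apply: nB; split => //; rewrite subr_ge0.
  by split => //; apply/eqP; rewrite -normr_eq0 eq_le normr_ge0 andbT -xt.
pose w t := x t `^ p.
(* A real power instead of an inverse, since powers are known to be
   measurable; the two agree on [B], where [x] is positive. *)
pose z t := y t * x t `^ (-1).
have zE t : B t -> z t = y t / x t.
  by move=> [xt _]; rewrite /z powR_inv1// ltW.
have w0 t : B t -> 0 < w t by move=> [xt _]; exact: powR_gt0.
have z1 t : B t -> `|z t| <= 1.
  move=> Bt; have [xt] := Bt; rewrite subr_ge0 => yx.
  by rewrite zE// normrM normfV (gtr0_norm xt) ler_pdivrMr// mul1r.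
have mz : measurable_fun B z.
  apply: measurable_funTS; apply: measurable_funM => //.
  exact: measurable_powR_comp.
have iw : mu.-integrable B (EFin \o w).
  have := integrableS measurableT mB (@subsetT _ _)
    (Lfun_integrable_powR _ _ _ _ _ _ p0 Lx).
  apply: eq_integrable => // t /set_mem[xt _] /=.
  by rewrite gtr0_norm.
have x_offB : {ae mu, forall t, ~ B t -> x t = 0}.
  by apply: filterS offB => t tB /tB[].
have y_offB : {ae mu, forall t, ~ B t -> y t = 0}.
  by apply: filterS offB => t tB /tB[].
have xy_offB : {ae mu, forall t, ~ B t -> (x \+ y) t = 0}.
  by apply: filterS offB => t tB /tB[/= -> ->]; rewrite addr0.
have NxE : Lp_norm mu p x = (\int[mu]_(t in B) w t) `^ p^-1.
  rewrite (Lp_norm_support _ _ _ _ _ _ _ mB mx x_offB p0).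
  congr (_ `^ _); apply: eq_Rintegral => t /set_mem[xt _].
  by rewrite gtr0_norm.
have NyE : Lp_norm mu p y = (\int[mu]_(t in B) (w t * `|z t| `^ p)) `^ p^-1.
  rewrite (Lp_norm_support _ _ _ _ _ _ _ mB my y_offB p0).
  congr (_ `^ _); apply: eq_Rintegral => t /set_mem Bt; have [xt _] := Bt.
  rewrite zE// normrM normfV (gtr0_norm xt) powR_div// /w mulrC mulfVK//.
  by rewrite gt_eqF// powR_gt0.
have NxyE : Lp_norm mu p (x \+ y) =
    (\int[mu]_(t in B) (w t * (1 + z t) `^ p)) `^ p^-1.
  rewrite (Lp_norm_support _ _ _ _ _ _ _ mB mxy xy_offB p0).
  congr (_ `^ _); apply: eq_Rintegral => t /set_mem Bt; have [xt yx] := Bt.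
  have := z1 _ Bt; rewrite ler_norml => /andP[z1t _].
  rewrite /w -powRM ?(ltW xt)//; last by lra.
  have -> : x t * (1 + z t) = x t + y t by rewrite zE//; field; rewrite gt_eqF.
  by rewrite /= ger0_norm//; have := ler_norm (- y t); rewrite normrN; lra.
have tangentE : \int[mu]_(t in [set t | 0 < x t]) (x t `^ (p - 1) * y t) =
    \int[mu]_(t in B) (w t * z t).
  rewrite Rintegral_mkcond [RHS]Rintegral_mkcond /Rintegral; congr fine.
  have mpos : measurable [set t | 0 < x t].
    have -> : [set t | 0 < x t] = x @^-1` `]0, +oo[.
      by apply/seteqP; split => t /=; rewrite in_itv/= andbT.
    by rewrite -[X in measurable X]setTI; exact: mx.
  apply: ae_eq_integral => //.
  - apply/measurable_EFinP/(measurable_restrictT _ mpos)/measurable_funTS.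
    apply: measurable_funM => //.
    exact: measurable_powR_comp.
  - apply/measurable_EFinP/(measurable_restrictT _ mB).
    apply: measurable_funM => //; apply: measurable_funTS.
    exact: measurable_powR_comp.
  apply: filterS offB => t nB _; congr EFin; rewrite !patchE.
  have [/set_mem Bt|/negP nBt] := boolP (t \in B).
    have [xt _] := Bt; have xn := lt0r_neq0 xt.
    rewrite mem_set// zE// /w powRB ?xn ?implybT// powRr1 ?(ltW xt)//.
    by field.
  have [] := nB (fun Bt => nBt (mem_set Bt)).
  by move=> xt yt; case: ifPn => // /set_mem /=; rewrite xt ltxx.
have I0 : 0 < \int[mu]_(t in B) w t.
  rewrite lt_neqAle eq_sym Rintegral_ge0 ?andbT; last by move=> t Bt; rewrite ltW// w0.
  apply/eqP => I0; apply: x_neq0; apply: (Lp_norm_eq0 _ _ _ _ _ _ p0 Lx).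
  by rewrite NxE I0 powR0// invr_eq0.
have sq a : (a `^ p^-1) ^+ 2 = a `^ (2 / p).
  by rewrite -powR_mulrn ?powR_ge0// -powRrM mulrC.
have Nx2 : Lp_norm mu p x ^+ 2 = (\int[mu]_(t in B) w t) `^ (2 / p).
  by rewrite NxE; exact: sq.
have Ny2 : Lp_norm mu p y ^+ 2 =
    (\int[mu]_(t in B) (w t * `|z t| `^ p)) `^ (2 / p).
  by rewrite NyE; exact: sq.
have Nxy2 : Lp_norm mu p (x \+ y) ^+ 2 =
    (\int[mu]_(t in B) (w t * (1 + z t) `^ p)) `^ (2 / p).
  by rewrite NxyE; exact: sq.
have Nxp : Lp_norm mu p x `^ (2 - p) =
    (\int[mu]_(t in B) w t) `^ (2 / p - 1).
  by rewrite NxE -powRrM; congr (_ `^ _); field.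
rewrite /cone_tangent; case: asboolP => // _.
rewrite tangentE Nxp Nxy2 Nx2 Ny2.
exact: weighted_smoothness1.
Qed.

(** * Optimality on a two-point space *)

(** The function [t |-> (1 + (1 + t)^p)^(2/p)] has second derivative
    [2 p 2^(2/p-2)] at [0], and it is continuous there, so it exceeds [2 K] on
    some [[0, s]]; Taylor's inequality for the opposite function concludes. *)
Lemma powR_second_order_lower (R : realType) (p K : R) :
  0 < p -> K < p * 2 `^ (2 / p - 2) ->
  exists2 s : R, 0 < s <= 1 &
    2 `^ (2 / p) + 2 * 2 `^ (2 / p - 1) * s + K * s ^+ 2
    <= (1 + (1 + s) `^ p) `^ (2 / p).
Proof.
move=> p0 ltK.
have pn : p != 0 by rewrite gt_eqF.
pose u (t : R) := 1 + (1 + t) `^ p.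
pose v (t : R) := 1 + t.
have dv (t : R) : is_derive t 1 v 1.
  have -> : v = cst 1 + id by apply/funext.
  by apply: is_derive_eq; rewrite add0r.
have v0 (t : R) : 0 <= t -> 0 < v t by rewrite /v => t0; lra.
have du (t : R) : 0 <= t -> is_derive t 1 u (p * v t `^ (p - 1)).
  move=> t0; have dp := is_derive_powR_comp _ v p _ _ (v0 t t0) (dv t).
  have -> : u = cst 1 + (fun t : R => v t `^ p) by apply/funext.
  by apply: is_derive_eq; rewrite add0r mulr1.
have u0 (t : R) : 0 <= t -> 0 < u t.
  by move=> t0; rewrite /u ltr_wpDr ?powR_ge0.
pose f (t : R) := u t `^ (2 / p).
pose f1 (t : R) := 2 * (u t `^ (2 / p - 1) * v t `^ (p - 1)).
pose f2 (t : R) := 2 * ((2 - p) * u t `^ (2 / p - 2) * v t `^ (p - 1) * v t `^ (p - 1)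
                  - (1 - p) * u t `^ (2 / p - 1) * v t `^ (p - 2)).
have df (t : R) : 0 <= t -> is_derive t 1 f (f1 t).
  move=> t0; have dp := is_derive_powR_comp _ u (2 / p) _ _ (u0 t t0) (du t t0).
  by apply: is_derive_eq; rewrite /f1; field.
have df1 (t : R) : 0 <= t -> is_derive t 1 f1 (f2 t).
  move=> t0.
  have dp := is_derive_powR_comp _ u (2 / p - 1) _ _ (u0 t t0) (du t t0).
  have dq := is_derive_powR_comp _ v (p - 1) _ _ (v0 t t0) (dv t).
  have -> : f1 = 2 \*: ((fun t : R => u t `^ (2 / p - 1))
      * (fun t : R => v t `^ (p - 1))).
    by apply/funext.
  apply: is_derive_eq; rewrite /GRing.scale/= /f2.
  rewrite (_ : 2 / p - 1 - 1 = 2 / p - 2); last by ring.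
  rewrite (_ : p - 1 - 1 = p - 2); last by ring.
  by field.
have f20 : f2 0 = 2 * (p * 2 `^ (2 / p - 2)).
  rewrite /f2 /u /v addr0 !powR1 !mulr1 (_ : 2 / p - 1 = 2 / p - 2 + 1); last by ring.
  by rewrite (@powRD _ 2 _ 1) ?pnatr_eq0 ?implybT// powRr1//; ring.
(* [f2] is continuous at [0] because it is even differentiable there. *)
have cf2 : {for 0, continuous f2}.
  have dp e := is_derive_powR_comp _ u e _ _ (u0 0 (lexx _)) (du 0 (lexx _)).
  have dq e := is_derive_powR_comp _ v e _ _ (v0 0 (lexx _)) (dv 0).
  have -> : f2 = 2 \*: (((2 - p) \*: (fun t : R => u t `^ (2 / p - 2)))
        * (fun t : R => v t `^ (p - 1)) * (fun t : R => v t `^ (p - 1))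
      - ((1 - p) \*: (fun t : R => u t `^ (2 / p - 1))) * (fun t : R => v t `^ (p - 2))).
    by apply/funext.
  apply/differentiable_continuous/derivable1_diffP.
  by apply: ex_derive.
have : \forall t \near (0 : R), 2 * K < f2 t.
  by have /= H := cvgr_gt _ cf2; apply: H; rewrite f20; lra.
move=> /nbhs_ballP[e /= e0 He].
pose s := Num.min 1 (e / 2).
have s0 : 0 < s by rewrite lt_min ltr01 divr_gt0.
have s1 : s <= 1 by rewrite ge_min lexx.
have se : s < e.
  by rewrite gt_min; apply/orP; right; lra.
exists s; first by rewrite s0.
have dNf (t : R) : 0 <= t <= s -> is_derive t 1 (- f) (- f1 t).
  by move=> /andP[t0 _]; have := df _ t0; exact: is_deriveN.
have dNf1 (t : R) : 0 <= t <= s -> is_derive t 1 (- f1) (- f2 t).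
  by move=> /andP[t0 _]; have := df1 _ t0; exact: is_deriveN.
have Nf2 (t : R) : 0 <= t <= s -> - f2 t <= - (2 * K).
  move=> /andP[t0 ts]; rewrite lerN2 ltW//; apply: He.
  by rewrite /ball/= sub0r normrN ger0_norm// (le_lt_trans ts).
have := taylor2_le _ (- f) (- f1) (fun t : R => - f2 t) _ _ (ltW s0) dNf dNf1 Nf2.
rewrite !fctE /f1 /f /u /v addr0 !powR1 mulr1 -[1 + 1]/(2%:R).
lra.
Qed.

Lemma two_point_integral (R : realType) (f : bool -> R) (D : set bool) :
  (forall b, 0 <= f b) ->
  \int[measure_add (dirac true) (dirac false)]_(b in D) f b =
  \1_D true * f true + \1_D false * f false.
Proof.
move=> f0; rewrite /Rintegral ge0_integral_measure_add//; last first.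
  by move=> b _; rewrite lee_fin.
by rewrite !integral_dirac//= -!EFinM.
Qed.

Lemma Lp_norm_two_point (R : realType) (p : R) (f : bool -> R) : 0 < p ->
  Lp_norm (measure_add (dirac true) (dirac false)) p f =
  (`|f true| `^ p + `|f false| `^ p) `^ p^-1.
Proof.
move=> p0; rewrite (Lp_norm_support _ _ _ _ [set: bool])//; last first.
  by apply: aeW => t [].
rewrite two_point_integral; last by move=> b; exact: powR_ge0.
by rewrite !indicT !mul1r.
Qed.

Lemma Lfun_two_point (R : realType) (p : R) (f : bool -> R) : 0 < p ->
  f \in Lfun (measure_add (dirac true) (dirac false)) p%:E.
Proof.
move=> p0; rewrite inE; apply/andP; split; rewrite inE//=.
rewrite /finite_norm unlock; apply: poweR_lty.
rewrite ge0_integral_measure_add//; last first.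
  by move=> b _; exact: poweR_ge0.
rewrite !integral_dirac// !diracT !mul1e /=.
by rewrite -EFinD ltry.
Qed.

(** With [x = 1] and [y = s] on one atom, [0] on the other, the assumed
    inequality bounds [(1 + (1 + s)^p)^(2/p)] from above by its first order
    expansion plus [C s^2]; powR_second_order_lower contradicts this for any [K]
    strictly between [C] and the optimal constant. *)
Lemma cone_smooth_constant_ge (R : realType) (p C : R) :
  0 < p -> cone_smooth_with p C -> p * 2 `^ (2 / p - 2) <= C.
Proof.
move=> p0 smooth; rewrite leNgt; apply/negP => ltC.
have pn : p != 0 by rewrite gt_eqF.
pose K := (C + p * 2 `^ (2 / p - 2)) / 2.
have [|s /andP[s0 s1]] := powR_second_order_lower _ p K p0; first by rewrite /K; lra.
pose mu : {measure set bool -> \bar R} := measure_add (dirac true) (dirac false).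
pose x (b : bool) : R := 1.
pose y (b : bool) : R := if b then s else 0.
have y0 b : 0 <= y b by rewrite /y; case: b; rewrite // ltW.
have y1 b : y b <= 1 by rewrite /y; case: b.
have xy_ge0 : {ae mu, forall b, 0 <= x b + y b}.
  by apply: aeW => b; rewrite addr_ge0// ler01.
have xy_ge0' : {ae mu, forall b, 0 <= x b - y b}.
  by apply: aeW => b; rewrite subr_ge0.
have sq (a : R) : (a `^ p^-1) ^+ 2 = a `^ (2 / p).
  by rewrite -powR_mulrn ?powR_ge0// -powRrM mulrC.
have NxE : Lp_norm mu p x = 2 `^ p^-1.
  by rewrite Lp_norm_two_point// normr1 powR1.
have Ny2 : Lp_norm mu p y ^+ 2 = s ^+ 2.
  rewrite Lp_norm_two_point// normr0 powR0// addr0 -powRrM mulfV//.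
  by rewrite powRr1// ger0_norm// ltW.
have Nxy2 : Lp_norm mu p (x \+ y) ^+ 2 = (1 + (1 + s) `^ p) `^ (2 / p).
  rewrite Lp_norm_two_point// sq /x /y /= addr0 normr1 powR1 addrC.
  by rewrite ger0_norm// addr_ge0// ltW.
have tangentE : cone_tangent mu p x y = 2 `^ (2 / p - 1) * s.
  rewrite /cone_tangent; case: asboolP => [x_eq0|_].
    have mx : measurable_fun [set: bool] x by [].
    have /eqP := Lp_norm_ae0 _ _ _ mu p x p0 mx x_eq0.
    by rewrite NxE powR_eq0 pnatr_eq0.
  rewrite two_point_integral; last by move=> b; rewrite mulr_ge0 ?powR_ge0.
  rewrite !indicE !mem_set ?ltr01//= !mul1r mulr0 addr0 /x powR1 mul1r.
  by rewrite NxE -powRrM; congr (_ `^ _ * _); field.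
have := smooth _ _ mu x y (Lfun_two_point _ _ _ p0) (Lfun_two_point _ _ _ p0)
  xy_ge0 xy_ge0'.
rewrite Nxy2 Ny2 tangentE NxE sq => up low.
have /le_trans/(_ up) := low.
rewrite -mulrA -subr_ge0 [X in 0 <= X](_ : _ = (C - K) * s ^+ 2); last by ring.
rewrite leNgt nmulr_rlt0 ?exprn_gt0//.
by rewrite /K; lra.
Qed.

Theorem theorem1p5 (R : realType) (p : R) (hp0 : 0 < p) (hp1 : p < 1) :
  cone_smooth_with p (p * 2 `^ (2 / p - 2)) /\
  (forall C : R, cone_smooth_with p C -> p * 2 `^ (2 / p - 2) <= C).
Proof.
split; first exact: cone_smooth_with_sharp.
by move=> C; exact: cone_smooth_constant_ge.
Qed.
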